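(* Let $b\ge1$ and let $K_n$ denote the capacity of the bucket containing label $n$ in a random bucket tree of size $n$ generated by the growth process. Let $\kappa=\frac1{d-1}$ for $(b,d)$-ary increasing trees and $\kappa=-\frac1{\alpha+1}$ for $(b,\alpha)$-plane oriented recursive trees, and let $\lambda_1,\dots,\lambda_b$ be the (distinct) complex solutions of $$\lambda(\lambda+1)\cdots(\lambda+b-1)=(b+\kappa)(b+\kappa-1)\cdots(1+\kappa),$$ with $\lambda_1=1+\kappa$. Then for all $n\ge1$ and $1\le m\le b$: for $(b,d)$-ary increasing trees $$\mathbb P\{K_n=m\}=\sum_{i=1}^b\frac{\binom{\lambda_i+n-2}{n-1}\binom{\lambda_i+b-1}{b-m}\binom{m-1+\frac1{d-1}}{m-1}}{\binom{n-1+\frac1{d-1}}{n-1}\binom{b}{m-1}(b-m+1)\binom{b+\frac1{d-1}}{b}\,(H_{\lambda_i+b-1}-H_{\lambda_i-1})},$$ and for $(b,\alpha)$-plane oriented recursive trees $$\mathbb P\{K_n=m\}=\sum_{i=1}^b\frac{\binom{\lambda_i+n-2}{n-1}\binom{\lambda_i+b-1}{b-m}\binom{m-1-\frac1{\alpha+1}}{m-1}}{\binom{n-1-\frac1{\alpha+1}}{n-1}\binom{b}{m-1}(b-m+1)\binom{b-\frac1{\alpha+1}}{b}\,(H_{\lambda_i+b-1}-H_{\lambda_i-1})}.$$ Moreover, as $n\to\infty$, $K_n$ converges in distribution to a random variable $K$ with, for $1\le m\le b$, $$\mathbb P\{K=m\}=\frac{\binom{b+\frac1{d-1}}{b-m}\binom{m-1+\frac1{d-1}}{m-1}}{\binom{b}{m-1}(b-m+1)\binom{b+\frac1{d-1}}{b}(H_{b+\frac1{d-1}}-H_{\frac1{d-1}})}\quad\text{($(b,d)$-ary)},$$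 $$\mathbb P\{K=m\}=\frac{\binom{b-\frac1{\alpha+1}}{b-m}\binom{m-1-\frac1{\alpha+1}}{m-1}}{\binom{b}{m-1}(b-m+1)\binom{b-\frac1{\alpha+1}}{b}(H_{b-\frac1{\alpha+1}}-H_{-\frac1{\alpha+1}})}\quad\text{($(b,\alpha)$-PORTs)}.$$
   Context: Binomials with complex upper argument: $\binom{x}{k}=x(x-1)\cdots(x-k+1)/k!$. For complex $x$ and integer $k\ge0$, $H_{x+k}-H_x:=\sum_{i=1}^k\frac1{x+i}$ (so $H_{\lambda+b-1}-H_{\lambda-1}=\sum_{i=0}^{b-1}\frac1{\lambda+i}$). Fix $b\ge1$. A bucket tree is a rooted unordered tree whose nodes (''buckets'') $v$ contain $c(v)\in\{1,\dots,b\}$ labels (capacity); $v$ is saturated if $c(v)=b$, and every node with a child is saturated; $d^+(v)$ is its number of children; the size is the total number of labels. Growth process: start with a root bucket containing label 1; given the tree of size $n\ge1$, choose a node $v$ with probability $p(v)$; if $v$ is unsaturated, add label $n+1$ to $v$, otherwise attach to $v$ a new child bucket containing only $n+1$. For $(b,d)$-ary increasing trees ($d\ge2$ integer): $p(v)=\frac{(d-1)c(v)+1-d^+(v)}{(d-1)n+1}$; for $(b,\alpha)$-plane oriented recursive trees ($\alpha>0$): $p(v)=\frac{d^+(v)+(\alpha+1)c(v)-1}{(\alpha+1)n-1}$ (capacities and out-degrees in the current tree of size $n$).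
   Formalization: Distinctness of the λ_i is assumed throughout, including for the limit law: it fails for isolated α in the PORT case (e.g. b=3, α/(α+1)=2/√3−1, where λ=−1−1/√3 is a double root and H_{λ+b−1}−H_{λ−1}=0, so the formula is undefined). *)

(* Defs.v *)
From HB Require Import structures.
From mathcomp Require Import all_boot all_order all_algebra.
From mathcomp Require Import all_classical all_reals all_analysis.
From mathcomp Require Import complex.
Set Implicit Arguments. Unset Strict Implicit. Unset Printing Implicit Defensive.
Import Order.TTheory GRing.Theory Num.Theory.
Local Open Scope ring_scope.

Definition binomF (F : fieldType) (x : F) (k : nat) : F :=
  (\prod_(j < k) (x - j%:R)) / (k`!)%:R.

(* H_{x+k} - H_x := sum_{i=1}^k 1/(x+i). *)
Definition Hdiff (F : fieldType) (x : F) (k : nat) : F :=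
  \sum_(i < k) (x + i.+1%:R)^-1.

Inductive model (R : Type) :=
  | Dary of nat
  | PORT of R.

Definition model_ok (R : realType) (M : model R) : Prop :=
  match M with Dary d => (2 <= d)%N | PORT a => 0 < a end.

Definition kappa (R : realType) (M : model R) : R :=
  match M with Dary d => (d%:R - 1)^-1 | PORT a => - (a + 1)^-1 end.

(* A bucket tree: a list of buckets; bucket = (parent index, labels).
   The root is the bucket with parent None (the first one); the other
   buckets have parent Some j, j the index of a previously created bucket.
   Capacity c(v) = number of labels; d^+(v) = number of buckets with parent v. *)
Definition bucket := (option nat * seq nat)%type.
Definition btree := seq bucket.

Definition cap (t : btree) (v : nat) : nat := size (nth (None, [::]) t v).2.
Definition outdeg (t : btree) (v : nat) : nat :=
  count (fun B : bucket => B.1 == Some v) t.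
Definition tsize (t : btree) : nat := sumn (map (fun B : bucket => size B.2) t).

Definition pchoose (R : realType) (M : model R) (t : btree) (v : nat) : R :=
  let n := tsize t in
  match M with
  | Dary d => ((d%:R - 1) * (cap t v)%:R + 1 - (outdeg t v)%:R)
              / ((d%:R - 1) * n%:R + 1)
  | PORT a => ((outdeg t v)%:R + (a + 1) * (cap t v)%:R - 1)
              / ((a + 1) * n%:R - 1)
  end.

Definition grow (b : nat) (t : btree) (v : nat) : btree :=
  let n := tsize t in
  if (cap t v < b)%N
  then set_nth (None, [::]) t v ((nth (None, [::]) t v).1,
                                  rcons (nth (None, [::]) t v).2 n.+1)
  else rcons t (Some v, [:: n.+1]).

(* Exact distribution (finite list of outcomes with probabilities) of the
   random bucket tree of size k.+1. *)
Fixpoint treedist (R : realType) (M : model R) (b : nat) (k : nat)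
  : seq (btree * R) :=
  match k with
  | 0 => [:: ([:: (None, [:: 1%N])], 1)]
  | k'.+1 =>
      flatten [seq [seq (grow b tp.1 v, tp.2 * pchoose M tp.1 v)
                   | v <- iota 0 (size tp.1)]
              | tp <- treedist M b k']
  end.

Definition capOfLabel (t : btree) (n : nat) : nat :=
  cap t (find (fun B : bucket => n \in B.2) t).

Definition probK (R : realType) (M : model R) (b n m : nat) : R :=
  \sum_(tp <- treedist M b n.-1) tp.2 * (capOfLabel tp.1 n == m)%:R.

(* Main.v *)
(** Writing kappa for the model parameter, both models choose a bucket [v] of a
   tree of size [n] with probability [(c(v) + kappa (1 - d^+(v))) / (n + kappa)].
   For any [g], the total [sum_v w(v) g(c(v))] of these weights changes under
   growth by an amount depending only on [c(v)] for the chosen [v], so the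
   capacity classes form a cyclic urn and
     (n + kappa) P(K_(n+1) = m+1) = (n-1-m) P(K_n = m+1) + (m + kappa) P(K_n = m),
     (n + kappa) P(K_(n+1) = 1) = (n-1) P(K_n = 1) + (b + kappa) P(K_n = b).
   Each root [lambda] of the characteristic equation yields a solution
     prod_(i < n-1) (lambda + i) / (1 + kappa + i) * coef(lambda, m).
   The initial condition is Lagrange interpolation at the nodes [lambda_j]: the
   denominator of [coef(lambda_j, m)] is [prod_(i != j) (lambda_j - lambda_i)] and its
   numerator has degree [b - m], with leading coefficient 1 when [m = 1].  For the
   limit, every root other than [1 + kappa] has real part [< 1 + kappa], so its
   product tends to 0 by divergence of the harmonic series. *)
Require Import Defs.
From HB Require Import structures.
From mathcomp Require Import all_boot all_order all_algebra.
From mathcomp Require Import all_classical all_reals all_analysis.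
From mathcomp Require Import complex ring lra zify.
Import Order.TTheory GRing.Theory Num.Theory.
Import numFieldNormedType.Exports.
Set Implicit Arguments. Unset Strict Implicit. Unset Printing Implicit Defensive.
Local Open Scope ring_scope.

(** * Growth of a bucket tree *)

(** The numerator of [pchoose] divided by [d - 1], respectively [a + 1]; this scaling gives both
    models the same form in [kappa]. *)
Definition weight (R : realType) (k : R) (t : btree) (v : nat) : R :=
  (cap t v)%:R + k * (1 - (outdeg t v)%:R).

Definition capweight (R : realType) (k : R) (g : nat -> R) (t : btree) : R :=
  \sum_(0 <= v < size t) weight k t v * g (cap t v).

(** Increment of [capweight] when the chosen bucket holds [c] labels. An unsaturated bucket has no
    child, so its weight is [c + k]; a saturated one gains a child and loses [k], while the new
    bucket brings [1 + k]. *)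
Definition cap_drift (R : realType) (k : R) (b : nat) (g : nat -> R) (c : nat) : R :=
  if (c < b)%N then (c.+1%:R + k) * g c.+1 - (c%:R + k) * g c
  else (1 + k) * g 1%N - k * g b.

(** The label bound makes [n.+1] fresh. For [0 < b] the last clause also covers indices outside [t],
    whose capacity is 0, so no bucket names a missing parent. *)
Definition valid_btree (b n : nat) (t : btree) : Prop :=
  [/\ Defs.tsize t = n,
      all (fun B : bucket => (0 < size B.2 <= b)%N && all (leq^~ n) B.2) t
    & forall u, (cap t u < b)%N -> outdeg t u = 0%N].

(** Keeps [n + kappa] positive for every [n >= 1], so that the recursions may be divided by it. *)
Lemma kappa_gtN1 (R : realType) (M : model R) : model_ok M -> -1 < kappa M.
Proof.
case: M => [d|a] /= h.
  have h2 : 2 <= d%:R :> R by rewrite (ler_nat _ 2 d).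
  by apply: lt_trans (_ : 0 < _); rewrite ?ltrN10 // invr_gt0; lra.
by rewrite ltrN2 invf_lt1; lra.
Qed.

Lemma pchooseE (R : realType) (M : model R) (t : btree) (v : nat) :
  model_ok M -> (0 < Defs.tsize t)%N ->
  pchoose M t v = weight (kappa M) t v / ((Defs.tsize t)%:R + kappa M).
Proof.
move=> hM t0; have k1 := kappa_gtN1 hM.
have n1 : 1 <= (Defs.tsize t)%:R :> R by rewrite (ler_nat _ 1).
move: k1; case: M hM => [d|a] /= h; rewrite /weight => k1.
  have h2 : 2 <= d%:R :> R by rewrite (ler_nat _ 2 d).
  have d1 : d%:R - 1 != 0 :> R by apply/eqP; lra.
  have e1 : (d%:R - 1) * (Defs.tsize t)%:R + 1 != 0 :> R by rewrite gt_eqF //; nra.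
  by field; rewrite d1 mulrC.
have d1 : a + 1 != 0 by rewrite gt_eqF //; lra.
have e1 : (a + 1) * (Defs.tsize t)%:R - 1 != 0 :> R by rewrite gt_eqF //; nra.
by field; rewrite d1 mulrC.
Qed.

Lemma cap_grow_fill (b : nat) (t : btree) (v u : nat) : (v < size t)%N -> (cap t v < b)%N ->
  cap (grow b t v) u = (cap t u + (u == v))%N.
Proof.
move=> vt cv; rewrite /grow cv {1}/cap nth_set_nth /=; case: eqP => [->|_] /=.
  by rewrite size_rcons addn1.
by rewrite addn0.
Qed.

Lemma outdeg_grow_fill (b : nat) (t : btree) (v u : nat) : (v < size t)%N -> (cap t v < b)%N ->
  outdeg (grow b t v) u = outdeg t u.
Proof.
move=> vt cv; rewrite /grow cv /outdeg set_nthE vt.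
rewrite -[in RHS](cat_take_drop v t) (drop_nth (None, [::]) vt).
by rewrite !count_cat.
Qed.

Lemma size_grow_fill (b : nat) (t : btree) (v : nat) : (v < size t)%N -> (cap t v < b)%N ->
  size (grow b t v) = size t.
Proof. by move=> vt cv; rewrite /grow cv size_set_nth; apply/maxn_idPr. Qed.

Lemma cap_grow_attach (b : nat) (t : btree) (v u : nat) : (b <= cap t v)%N ->
  cap (grow b t v) u = (cap t u + (u == size t))%N.
Proof.
rewrite leqNgt /grow => /negbTE ->; rewrite /cap nth_rcons.
by case: ltngtP => h /=; rewrite ?addn0 // nth_default ?h // ltnW.
Qed.

Lemma outdeg_grow_attach (b : nat) (t : btree) (v u : nat) : (b <= cap t v)%N ->
  outdeg (grow b t v) u = (outdeg t u + (u == v))%N.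
Proof.
rewrite leqNgt /grow => /negbTE ->; rewrite /outdeg -cats1 count_cat /= addn0.
by rewrite (inj_eq Some_inj) eq_sym.
Qed.

Lemma size_grow_attach (b : nat) (t : btree) (v : nat) : (b <= cap t v)%N ->
  size (grow b t v) = (size t).+1.
Proof. by rewrite leqNgt /grow => /negbTE ->; rewrite size_rcons. Qed.

Lemma cap_out (t : btree) (u : nat) : (size t <= u)%N -> cap t u = 0%N.
Proof. by move=> h; rewrite /cap nth_default. Qed.

(** * Effect of one growth step on a valid tree *)

Section Valid.
Variables (b n : nat) (t : btree).
Hypotheses (b0 : (0 < b)%N) (ht : valid_btree b n t).

Lemma valid_cap_le u : (cap t u <= b)%N.
Proof.
have [h|h] := ltnP u (size t); last by rewrite cap_out.
case: ht => _ /(all_nthP (None, [::])) /(_ _ h) /andP[/andP[_ //]].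
Qed.

Lemma valid_cap_gt0 u : (u < size t)%N -> (0 < cap t u)%N.
Proof.
by move=> h; case: ht => _ /(all_nthP (None, [::])) /(_ _ h) /andP[/andP[//]].
Qed.

Lemma valid_new_label : all (fun B : bucket => n.+1 \notin B.2) t.
Proof.
case: ht => _ h _; apply: sub_all h => B /andP[_ /allP h].
by apply/negP => /h; rewrite ltnn.
Qed.

Lemma tsize_grow v : (v < size t)%N -> Defs.tsize (grow b t v) = n.+1.
Proof.
move=> vt; case: ht => <- _ _; rewrite /grow; case: ifP => cv.
  rewrite /Defs.tsize set_nthE vt -[in RHS](cat_take_drop v t) (drop_nth (None, [::]) vt).
  by rewrite !map_cat !sumn_cat /= size_rcons addSn addnS.
by rewrite /Defs.tsize -cats1 map_cat sumn_cat /= addn1.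
Qed.

Lemma valid_grow v : (v < size t)%N -> valid_btree b n.+1 (grow b t v).
Proof.
move=> vt; split; first exact: tsize_grow.
- case: ht => tn al _.
  have al' : all (fun B : bucket => (0 < size B.2 <= b)%N && all (leq^~ n.+1) B.2) t.
    apply: sub_all al => B /andP[-> /= h].
    by apply: sub_all h => x xn; exact: leqW.
  rewrite /grow tn; case: ifP => cv; last first.
    by rewrite all_rcons /= b0 leqnn.
  rewrite set_nthE vt.
  move: al'; rewrite -{1}(cat_take_drop v t) (drop_nth (None, [::]) vt) !all_cat /=.
  move=> /andP[-> /andP[/andP[_ h] ->]] /=.
  by rewrite size_rcons all_rcons leqnn h !andbT.
- move=> u; case: ht => _ _ h; have [cv|cv] := ltnP (cap t v) b.
    rewrite cap_grow_fill // outdeg_grow_fill // => hu; apply: h; lia.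
  rewrite cap_grow_attach // outdeg_grow_attach // => hu; rewrite h; last by lia.
  by case: (u =P v) hu => [->|_ _ //]; lia.
Qed.

(** No old bucket contains [n.+1], so [find] stops exactly at the bucket that growth has filled or
    created. *)
Lemma capOfLabel_grow v : (v < size t)%N ->
  capOfLabel (grow b t v) n.+1 = if (cap t v < b)%N then (cap t v).+1 else 1%N.
Proof.
move=> vt; have nl := valid_new_label; case: ht => tn _ _.
rewrite /capOfLabel /grow tn; case: ifP => cv.
  rewrite set_nthE vt find_cat.
  move: nl; rewrite -{1}(cat_take_drop v t) all_cat all_predC => /andP[/negbTE-> _].
  rewrite /= mem_rcons inE eqxx /= addn0 size_take vt.
  by rewrite /cap nth_cat size_take vt ltnn subnn /= size_rcons.
move: nl; rewrite all_predC -cats1 find_cat => /negbTE->.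
by rewrite /= inE eqxx addn0 /cap nth_cat ltnn subnn.
Qed.

Lemma capweight_grow (R : realType) (k : R) (g : nat -> R) v : (v < size t)%N ->
  capweight k g (grow b t v) = capweight k g t + cap_drift k b g (cap t v).
Proof.
move=> vt; case: (ht) => _ _ h0; have vi : v \in index_iota 0 (size t) by rewrite mem_index_iota.
rewrite /capweight /cap_drift; case: ltnP => cv.
  rewrite size_grow_fill // !(bigD1_seq v) ?iota_uniq //=.
  rewrite (eq_bigr (fun u => weight k t u * g (cap t u))); last first.
    move=> u /negbTE uv; rewrite /weight cap_grow_fill // outdeg_grow_fill // uv.
    by rewrite addn0.
  rewrite /weight cap_grow_fill // outdeg_grow_fill // eqxx h0 // addn1.
  by ring.
have cb : cap t v = b by apply/eqP; rewrite eqn_leq cv valid_cap_le.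
rewrite size_grow_attach // big_nat_recr //=.
(* Among the old buckets only [v], of capacity [b], changes its weight: it loses [k]. *)
rewrite (eq_big_seq (fun u => weight k t u * g (cap t u) - k * g b * (u == v)%:R)); last first.
  move=> u; rewrite mem_index_iota /= => ut.
  rewrite /weight cap_grow_attach // outdeg_grow_attach // (ltn_eqF ut) addn0.
  by rewrite natrD; case: eqP => [->|_] /=; rewrite ?cb; ring.
have -> : \sum_(0 <= u < size t) (weight k t u * g (cap t u) - k * g b * (u == v)%:R)
    = \sum_(0 <= u < size t) weight k t u * g (cap t u) - k * g b.
  rewrite big_split /= sumrN -mulr_sumr [in X in _ - X](bigD1_seq v) ?iota_uniq //= eqxx.
  by rewrite [X in _ * (_ + X)]big1 ?addr0 ?mulr1 // => u /negbTE ->.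
rewrite /weight cap_grow_attach // outdeg_grow_attach // eqxx gtn_eqF // addn0.
  (* The new index lies outside [t], so validity gives it out-degree 0. *)
  by rewrite (h0 (size t)) cap_out //= !add0n; ring.
Qed.

End Valid.

(** * Recursion for the law of the capacity *)

Section Process.
Variables (R : realType) (M : model R) (b : nat).
Hypotheses (hM : model_ok M) (b0 : (0 < b)%N).
Local Notation k := (kappa M).

Definition tree_mean (n : nat) (f : btree -> R) : R :=
  \sum_(tp <- treedist M b n) tp.2 * f tp.1.

Lemma tree_meanS n f : tree_mean n.+1 f =
  tree_mean n (fun t => \sum_(0 <= v < size t) pchoose M t v * f (grow b t v)).
Proof.
rewrite /tree_mean /= big_flatten big_map; apply: eq_bigr => tp _ /=.
rewrite big_map /index_iota subn0 mulr_sumr.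
by apply: eq_bigr => v _; rewrite mulrA.
Qed.

(** For the constant function 1 the drift is 1 in both cases, which yields the total weight; hence
    the selection probabilities sum to 1. *)
Lemma treedist_valid n tp : tp \in treedist M b n ->
  valid_btree b n.+1 tp.1 /\ capweight k (fun=> 1) tp.1 = n.+1%:R + k.
Proof.
elim: n tp => [|n IH] tp /=.
  rewrite inE => /eqP ->; split.
    by split => //=; rewrite b0.
  by rewrite /capweight big_nat1 /weight /cap /outdeg /=; ring.
move=> /flatten_mapP[tp' /IH[h1 h2]] /mapP[v]; rewrite mem_iota => /= vt ->.
split; first exact: valid_grow.
rewrite (capweight_grow b0 h1) // h2 /cap_drift -[n.+2%:R]natr1.
by case: ifP => _; rewrite -?natr1; ring.
Qed.

Lemma eq_tree_mean n f g : (forall t, valid_btree b n.+1 t ->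
  capweight k (fun=> 1) t = n.+1%:R + k -> f t = g t) -> tree_mean n f = tree_mean n g.
Proof.
move=> h; apply: eq_big_seq => tp /treedist_valid[h1 h2].
by rewrite h.
Qed.

Lemma sum_pchoose n t (f : nat -> R) : valid_btree b n.+1 t ->
  \sum_(0 <= v < size t) pchoose M t v * f (cap t v) =
  capweight k f t / (n.+1%:R + k).
Proof.
case=> tn _ _; rewrite /capweight mulr_suml; apply: eq_bigr => v _.
by rewrite pchooseE ?tn // mulrAC.
Qed.

Lemma nk_gt0 n : 0 < n.+1%:R + k.
Proof.
have := kappa_gtN1 hM; have : 1 <= n.+1%:R :> R by rewrite (ler_nat _ 1).
lra.
Qed.

Lemma tree_mean_capweightS n (g : nat -> R) :
  tree_mean n.+1 (capweight k g) =
  tree_mean n (capweight k g) + tree_mean n (capweight k (cap_drift k b g)) / (n.+1%:R + k).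
Proof.
rewrite tree_meanS /tree_mean mulr_suml -big_split /=.
apply: eq_big_seq => tp /treedist_valid[h1 h2].
rewrite -mulrA -mulrDr; congr (_ * _).
rewrite -(sum_pchoose _ h1).
under eq_big_seq => v.
  rewrite mem_index_iota => /= vt; rewrite (capweight_grow b0 h1) // mulrDr.
  over.
rewrite big_split /= -mulr_suml; congr (_ + _).
have := sum_pchoose (fun=> 1) h1; rewrite h2 divff ?gt_eqF ?nk_gt0 //.
under eq_bigr do rewrite mulr1.
by move=> ->; rewrite mul1r.
Qed.

(** Indicator that the next label ends up in a bucket of capacity [m] when the chosen bucket holds
    [c] labels. *)
Definition filled (m c : nat) : R := ((if (c < b)%N then c.+1 else 1%N) == m)%:R.

(** The law of a label is a linear statistic of the preceding tree, so a recursion for it follows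
    from the drift of [filled m]. *)
Lemma probKS n m :
  probK M b n.+2 m = tree_mean n (capweight k (filled m)) / (n.+1%:R + k).
Proof.
rewrite -[LHS]/(tree_mean n.+1 (fun t => (capOfLabel t n.+2 == m)%:R)) tree_meanS.
rewrite /tree_mean mulr_suml; apply: eq_big_seq => tp /treedist_valid[h1 _].
rewrite -mulrA -(sum_pchoose _ h1); congr (_ * _).
apply: eq_big_seq => v; rewrite mem_index_iota => /= vt.
by rewrite (capOfLabel_grow h1).
Qed.

Lemma eq_capweight n t (g h : nat -> R) : valid_btree b n.+1 t ->
  (forall c, (0 < c <= b)%N -> g c = h c) -> capweight k g t = capweight k h t.
Proof.
move=> ht gh; apply: eq_big_seq => v; rewrite mem_index_iota => /= vt.
by rewrite gh // (valid_cap_gt0 ht) // (valid_cap_le ht).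
Qed.

Lemma capweight_lin t (x y : R) (g h : nat -> R) :
  capweight k (fun c => x * g c + y * h c) t = x * capweight k g t + y * capweight k h t.
Proof.
rewrite /capweight !mulr_sumr -big_split; apply: eq_bigr => v _ /=; ring.
Qed.

Lemma tree_mean_lin n (x y : R) (f g : btree -> R) :
  tree_mean n (fun t => x * f t + y * g t) = x * tree_mean n f + y * tree_mean n g.
Proof.
rewrite /tree_mean !mulr_sumr -big_split; apply: eq_bigr => v _ /=; ring.
Qed.

Lemma tree_mean_drift n (x y : R) (f g h : nat -> R) :
  (forall c, (0 < c <= b)%N -> cap_drift k b f c = x * g c + y * h c) ->
  tree_mean n (capweight k (cap_drift k b f)) =
  x * tree_mean n (capweight k g) + y * tree_mean n (capweight k h).
Proof.
move=> e; rewrite -tree_mean_lin; apply: eq_tree_mean => t ht _.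
by rewrite -capweight_lin; apply: eq_capweight ht e.
Qed.

(** On capacities [1..b], [filled m.+1] singles out buckets with exactly [m] labels. Choosing one
    removes weight [m + k] from that class; an outcome counted by [filled m] produces a bucket of
    that weight in it. *)
Lemma drift_filledS m c : (0 < m < b)%N -> (0 < c <= b)%N ->
  cap_drift k b (filled m.+1) c = (m%:R + k) * filled m c + (- (m%:R + k)) * filled m.+1 c.
Proof.
move=> mb cb; rewrite /cap_drift /filled ltnn.
have -> : (1 < b)%N by lia.
case: (ltnP c b) => cb'; rewrite !eqSS.
  have -> : (if (c.+1 < b)%N then c.+2 else 1%N) == m.+1 = (c.+1 == m).
    by case: ifP; lia.
  by case: eqP => [<-|_]; case: eqP => [<-|_] /=; rewrite -?natr1; ring.
by rewrite (ltn_eqF (proj1 (andP mb))); case: eqP => [<-|_] /=; ring.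
Qed.

(** Closes the cycle: [filled 1] singles out saturated buckets, which remain saturated when chosen
    and only lose [k]. *)
Lemma drift_filled1 c : (0 < c <= b)%N ->
  cap_drift k b (filled 1) c = (b%:R + k) * filled b c + (- k) * filled 1 c.
Proof.
move=> cb; rewrite /cap_drift /filled ltnn.
case: (ltnP c b) => cb'; last first.
  case: (ltnP 1 b) => b1; first by rewrite (ltn_eqF b1) /=; ring.
  by rewrite (_ : b = 1%N); [rewrite /=; ring|lia].
have -> : (c.+1 == 1%N) = false by lia.
case: (ltnP c.+1 b) => b1; first by rewrite (ltn_eqF b1) /=; ring.
rewrite (_ : b = c.+1); last by lia.
by rewrite !eqxx /= -?natr1; ring.
Qed.

Lemma probK_one m : probK M b 1 m = (m == 1%N)%:R.
Proof. by rewrite /probK big_seq1 /= mul1r eq_sym. Qed.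

Lemma probK_two m : probK M b 2 m = filled m 1.
Proof.
rewrite probKS /tree_mean big_seq1 /= mul1r /capweight big_nat1 /weight /cap /outdeg /=.
by rewrite subr0 mulr1 mulrAC divff ?mul1r // gt_eqF // (nk_gt0 0).
Qed.

Lemma probK_recS n m : (0 < m < b)%N -> (n.+1%:R + k) * probK M b n.+2 m.+1 =
  (n%:R - m%:R) * probK M b n.+1 m.+1 + (m%:R + k) * probK M b n.+1 m.
Proof.
(* [probKS] starts at label 2, so the passage from label 1 to label 2 is computed directly. *)
move=> mb; have nk := nk_gt0; case: n => [|n].
  rewrite probK_two !probK_one /filled.
  have -> : (1 < b)%N by lia.
  by rewrite !eqSS; case: m mb => [|[|m]] //= _; ring.
rewrite !probKS tree_mean_capweightS (tree_mean_drift _ (fun c => @drift_filledS m c mb)) -!natr1.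
have := nk n; have := nk n.+1; rewrite -!natr1.
by move=> h1 h2; field; rewrite !gt_eqF.
Qed.

Lemma probK_rec1 n : (n.+1%:R + k) * probK M b n.+2 1 =
  n%:R * probK M b n.+1 1 + (b%:R + k) * probK M b n.+1 b.
Proof.
have nk := nk_gt0; case: n => [|n].
  rewrite probK_two !probK_one /filled.
  case: (ltnP 1 b) => b1; first by rewrite (gtn_eqF b1) /=; ring.
  by rewrite (_ : b = 1%N); [rewrite /=; ring|lia].
rewrite !probKS tree_mean_capweightS (tree_mean_drift _ drift_filled1) -!natr1.
have := nk n; have := nk n.+1; rewrite -!natr1.
by move=> h1 h2; field; rewrite !gt_eqF.
Qed.
End Process.

(** * Solution of the recursion by Lagrange interpolation *)

Definition rising (F : nzRingType) (x : F) (n : nat) : F := \prod_(i < n) (x + i%:R).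

Lemma risingS (F : nzRingType) (x : F) n : rising x n.+1 = rising x n * (x + n%:R).
Proof. by rewrite /rising big_ord_recr. Qed.

Lemma risingSl (F : nzRingType) (x : F) n : rising x n.+1 = x * rising (x + 1) n.
Proof.
rewrite /rising big_ord_recl /= addr0; congr (_ * _); apply: eq_bigr => i _.
by rewrite -addrA nat1r.
Qed.

Lemma binomF_rising (F : fieldType) (x : F) n : binomF (x + n%:R - 1) n = rising x n / n`!%:R.
Proof.
rewrite /binomF /rising (reindex_inj rev_ord_inj); congr (_ / _).
apply: eq_bigr => i _ /=; rewrite natrB //.
by rewrite -natr1; ring.
Qed.

Section Lagrange.
Variables (F : fieldType) (b : nat) (lam : 'I_b -> F).
Hypothesis lam_inj : injective lam.

Definition node_diff (j : 'I_b) : F := \prod_(i | i != j) (lam j - lam i).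

Lemma node_diff_neq0 j : node_diff j != 0.
Proof.
apply/prodf_neq0 => i ij; rewrite subr_eq0; apply: contra ij => /eqP/lam_inj ->.
exact: eqxx.
Qed.

Lemma poly_eq_nodes (p q : {poly F}) : (size (p - q)%R <= b)%N ->
  (forall j, p.[lam j] = q.[lam j]) -> p = q.
Proof.
move=> sz e; apply/eqP; rewrite -subr_eq0; apply/eqP.
apply: (@roots_geq_poly_eq0 _ _ (codom lam)).
- by apply/allP => _ /codomP[j ->]; rewrite /root hornerD hornerN e subrr.
- exact/injectiveP.
- by rewrite size_codom card_ord.
Qed.

(** Compares the coefficients of degree [b - 1] in the Lagrange interpolation formula; each basis
    product [q j] is monic of that degree. *)
Lemma lead_coef_nodes (f : {poly F}) : (size f <= b)%N ->
  \sum_j f.[lam j] / node_diff j = f`_b.-1.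
Proof.
move=> sf; pose q j := \prod_(i | i != j) ('X - (lam i)%:P) : {poly F}.
have sq j : size (q j) = b.
  rewrite /q -big_filter size_prod_XsubC; have [e _ _ [_ ->]] := big_enumP.
  have := max_card (pred1 j); have := cardC1 j; rewrite card_ord => -> _.
  by case: (b) j => [[]//|].
have qm j : (q j)`_b.-1 = 1.
  by have /monicP := monic_prod_XsubC (index_enum 'I_b) (fun i => i != j) lam; rewrite /lead_coef sq.
have fE : f = \sum_j (f.[lam j] / node_diff j) *: q j.
  apply: poly_eq_nodes => [|j].
    apply: (leq_trans (size_polyD _ _)); rewrite geq_max sf size_polyN /=.
    apply: (leq_trans (size_sum _ _ _)); apply/bigmax_leqP => j _.
    by apply: (leq_trans (size_scale_leq _ _)); rewrite sq.
  rewrite horner_sum (bigD1 j) //= big1 => [|i ij].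
    rewrite hornerZ addr0 horner_prod.
    rewrite [X in _ * X](_ : _ = node_diff j); first by rewrite divfK ?node_diff_neq0.
    by apply: eq_bigr => i _; rewrite hornerXsubC.
  rewrite hornerZ horner_prod (bigD1 j) /=; last by rewrite eq_sym.
  by rewrite hornerXsubC subrr mul0r mulr0.
rewrite [in RHS]fE coef_sum; apply: eq_bigr => j _.
by rewrite coefZ qm mulr1.
Qed.
End Lagrange.

Lemma deriv_prod_XsubC (F : fieldType) (I : Type) (r : seq I) (c : I -> F) (x : F) :
  \prod_(i <- r) (x - c i) != 0 ->
  (\prod_(i <- r) ('X - (c i)%:P))^`().[x] =
  \prod_(i <- r) (x - c i) * \sum_(i <- r) (x - c i)^-1.
Proof.
elim: r => [|i r IH]; first by rewrite !big_nil derivC horner0 mulr0.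
rewrite !big_cons mulf_eq0 negb_or => /andP[h1 h2].
rewrite derivM derivXsubC !hornerE IH // horner_prod.
under eq_bigr do rewrite hornerXsubC.
by field.
Qed.

(** * Modes of the recursion and their superposition *)

Section Formula.
Variables (F : numFieldType) (k : F) (b : nat) (lam : 'I_b -> F).
Hypotheses (b0 : (0 < b)%N) (lam_inj : injective lam).
Hypothesis k_neq : forall n, n.+1%:R + k != 0.
Hypothesis lamE : forall j, rising (lam j) b = rising (1 + k) b.

Lemma rising1k_neq0 n : rising (1 + k) n != 0.
Proof. by apply/prodf_neq0 => i _; rewrite addrAC nat1r. Qed.

Definition hsum (x : F) : F := \sum_(i < b) (x + i%:R)^-1.

(** Two monic polynomials of degree [b] differ by one of degree below [b], which vanishes at the [b]
    distinct roots. *)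
Lemma prod_lam : \prod_(i < b) ('X - (- i%:R)%:P) - (rising (1 + k) b)%:P
  = \prod_j ('X - (lam j)%:P).
Proof.
have sz c : size (\prod_(i < b) ('X - (c i)%:P) : {poly F}) = b.+1.
  by rewrite size_prod_XsubC /index_enum -enumT size_enum_ord.
have ld c : (\prod_(i < b) ('X - (c i)%:P) : {poly F})`_b = 1.
  by have /monicP := monic_prod_XsubC (index_enum 'I_b) predT c; rewrite /lead_coef sz.
apply: (poly_eq_nodes lam_inj) => [|j].
  apply/leq_sizeP => i; rewrite leq_eqVlt => /orP[/eqP <-|bi].
    by rewrite !coefB coefC gtn_eqF // subr0 !ld subrr.
  by rewrite !coefB coefC gtn_eqF ?(leq_trans _ bi) // !nth_default ?sz // !subr0.
rewrite !hornerE !horner_prod [RHS](bigD1 j) //= hornerXsubC subrr mul0r.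
apply/eqP; rewrite subr_eq0 -(lamE j); apply/eqP; apply: eq_bigr => i _.
by rewrite hornerXsubC opprK.
Qed.

(** Differentiating [prod_lam] at [lam j] leaves [node_diff] on the right; on the left the constant
    disappears and the logarithmic derivative gives [hsum]. *)
Lemma node_diffE j : node_diff lam j = rising (1 + k) b * hsum (lam j).
Proof.
have e : \prod_(i < b) (lam j - - i%:R) = rising (1 + k) b.
  by rewrite -(lamE j); apply: eq_bigr => i _; rewrite opprK.
have h : \prod_(i < b) (lam j - - i%:R) != 0 by rewrite e rising1k_neq0.
have := deriv_prod_XsubC h; rewrite e.
have <- : hsum (lam j) = \sum_(i < b) (lam j - - i%:R)^-1.
  by apply: eq_bigr => i _; rewrite opprK.
move=> <-; have /(congr1 (fun p => p^`().[lam j])) := prod_lam.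
rewrite derivB derivC subr0 => ->.
rewrite (bigD1 j) //= derivM derivXsubC !hornerE subrr mul0r addr0 horner_prod.
by apply: eq_bigr => i _; rewrite hornerXsubC.
Qed.

(** The summand of the claimed formula without its dependence on [n], after cancelling the
    factorials of the binomials. *)
Definition law_coef (x : F) (m : nat) : F :=
  rising (x + m%:R) (b - m) * rising (1 + k) m.-1 / (rising (1 + k) b * hsum x).

Lemma law_coefS j m : (0 < m < b)%N ->
  (lam j + m%:R) * law_coef (lam j) m.+1 = (m%:R + k) * law_coef (lam j) m.
Proof.
case: m => // m mb; rewrite /law_coef /= (_ : (b - m.+1)%N = (b - m.+2).+1); last by lia.
rewrite (risingSl (lam j + m.+1%:R)) risingS (_ : lam j + m.+1%:R + 1 = lam j + m.+2%:R); last by rewrite -addrA natr1.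
by rewrite -[m.+1%:R]nat1r; ring.
Qed.

(** The wrap from class [b] to class 1 is where the characteristic equation enters. *)
Lemma law_coef1 j : lam j * law_coef (lam j) 1 = (b%:R + k) * law_coef (lam j) b.
Proof.
rewrite /law_coef /= subnn [rising _ 0]big_ord0 [rising _ 0]big_ord0.
rewrite mulr1 mul1r !mulrA -risingSl subn1 prednK // lamE.
case: (b) b0 => // b' _; rewrite risingS -nat1r /=; congr (_ / _); ring.
Qed.

Lemma sum_law_coef m : (0 < m <= b)%N -> \sum_j law_coef (lam j) m = (m == 1%N)%:R.
Proof.
move=> mb; pose f := \prod_(i < b - m) ('X - (- (m%:R + i%:R))%:P) : {poly F}.
have sf : size f = (b - m).+1.
  by rewrite /f size_prod_XsubC /index_enum -enumT size_enum_ord.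
have -> : \sum_j law_coef (lam j) m = rising (1 + k) m.-1 * \sum_j f.[lam j] / node_diff lam j.
  rewrite mulr_sumr; apply: eq_bigr => j _; rewrite /law_coef -node_diffE mulrA; congr (_ / _).
  rewrite mulrC; congr (_ * _); rewrite horner_prod; apply: eq_bigr => i _.
  by rewrite hornerXsubC opprK addrA.
rewrite lead_coef_nodes ?sf; [|exact: lam_inj|lia].
case: eqP => [m1|m1].
  rewrite m1 [rising _ 0]big_ord0 mul1r.
  have /monicP := monic_prod_XsubC (index_enum 'I_(b - m)) predT (fun i => - (m%:R + i%:R) : F).
  by rewrite -/f /lead_coef sf m1 subn1.
by rewrite nth_default ?mulr0 // sf; lia.
Qed.

Definition label_law (n m : nat) : F :=
  \sum_j law_coef (lam j) m * (rising (lam j) n / rising (1 + k) n).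

Lemma label_law0 m : (0 < m <= b)%N -> label_law 0 m = (m == 1%N)%:R.
Proof.
move=> mb; rewrite -sum_law_coef //; apply: eq_bigr => j _.
by rewrite /rising !big_ord0 divr1 mulr1.
Qed.

(** Holds mode by mode: [law_coefS] turns the last term into [lam j + m] times the coefficient at
    [m.+1], and [(n - m) + (lam j + m) = lam j + n] is the new factor of [rising]. *)
Lemma label_lawS n m : (0 < m < b)%N ->
  (n.+1%:R + k) * label_law n.+1 m.+1 =
  (n%:R - m%:R) * label_law n m.+1 + (m%:R + k) * label_law n m.
Proof.
move=> mb; rewrite /label_law !mulr_sumr -big_split; apply: eq_bigr => j _ /=.
rewrite [X in _ = _ + X]mulrA -law_coefS // !risingS -nat1r.
have := k_neq n; have := rising1k_neq0 n; rewrite -nat1r => h1 h2.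
by field; rewrite h1 /= addrAC.
Qed.

Lemma label_law1 n : (n.+1%:R + k) * label_law n.+1 1 =
  n%:R * label_law n 1 + (b%:R + k) * label_law n b.
Proof.
rewrite /label_law !mulr_sumr -big_split; apply: eq_bigr => j _ /=.
rewrite [X in _ = _ + X]mulrA -law_coef1 // !risingS -nat1r.
have := k_neq n; have := rising1k_neq0 n; rewrite -nat1r => h1 h2.
by field; rewrite h1 /= addrAC.
Qed.

Lemma law_coef_binomF (x : F) m : (0 < m <= b)%N ->
  binomF (x + b%:R - 1) (b - m) * binomF (m%:R - 1 + k) m.-1
  / ('C(b, m.-1)%:R * (b - m + 1)%:R * binomF (b%:R + k) b * Hdiff (x - 1) b) = law_coef x m.
Proof.
case: m => // m mb.
rewrite (_ : x + b%:R - 1 = (x + m.+1%:R) + (b - m.+1)%:R - 1); last first.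
  by rewrite natrB ?(proj2 (andP mb)) //; ring.
rewrite (_ : m.+1%:R - 1 + k = (1 + k) + m.+1.-1%:R - 1); last by rewrite -natr1 /=; ring.
rewrite (_ : b%:R + k = (1 + k) + b%:R - 1); last by ring.
rewrite !binomF_rising /law_coef.
have -> : Hdiff (x - 1) b = hsum x.
  by apply: eq_bigr => i _; rewrite -nat1r addrA subrK.
have bf : 'C(b, m.+1.-1)%:R * (m.+1.-1)`!%:R * ((b - m.+1 + 1)%:R * (b - m.+1)`!%:R) = b`!%:R :> F.
  rewrite -!natrM -(@bin_fact b m) ?(ltnW (proj2 (andP mb))) //= -mulnA.
  by rewrite addn1 -factS -subSn ?(proj2 (andP mb)).
have fn n : n`!%:R != 0 :> F by rewrite pnatr_eq0 -lt0n fact_gt0.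
have := fn b; rewrite -{1 2}bf !mulf_eq0 !negb_or => /andP[/andP[h1 h2] /andP[h3 h4]].
(* If [hsum x] vanishes, both sides are 0 by the convention for the inverse of 0. *)
have [->|h5] := eqVneq (hsum x) 0; first by rewrite !mulr0 invr0 !mulr0.
have h6 := rising1k_neq0 b.
move: h1 h2 h3 h4; move: (b - m.+1 + 1)%:R (b - m.+1)`!%:R => u v h1 h2 h3 h4.
by field; rewrite h1 h2 h3 h4 h5 h6.
Qed.
End Formula.

Local Open Scope complex_scope.
Local Open Scope classical_set_scope.

(** * Decay of the non-dominant terms *)

(** With [T n = 1 + eta * (S n - S N)] for the harmonic sums [S], the product [v n * T n] stays
    below [v N] while [T n] diverges. *)
Lemma harmonic_contraction_cvg0 (R : realType) (v : nat -> R) (eta : R) (N : nat) :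
  0 < eta -> (forall n, 0 <= v n) ->
  (forall n, (N <= n)%N -> v n.+1 <= v n * (1 - eta / n.+1%:R)) ->
  v n @[n --> \oo] --> 0.
Proof.
move=> eta0 v0 vS; pose S : nat -> R := series harmonic.
have SS n : S n.+1 = S n + n.+1%:R^-1 by rewrite /S /series /= big_nat_recr.
pose T n := 1 + eta * (S n - S N).
have Tbound n : (N <= n)%N -> 1 <= T n /\ v n * T n <= v N.
  elim: n => [|n IH]; first by rewrite leqn0 => /eqP N0; rewrite /T N0 subrr mulr0 addr0 mulr1.
  rewrite leq_eqVlt => /orP[/eqP <-|]; first by rewrite /T subrr mulr0 addr0 mulr1.
  rewrite ltnS => Nn; have [T1 vT] := IH Nn.
  have e0 : 0 < eta / n.+1%:R by rewrite divr_gt0.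
  have -> : T n.+1 = T n + eta / n.+1%:R by rewrite /T SS; ring.
  have := vS n Nn; have := v0 n; have := v0 n.+1.
  move: e0 T1 vT; move: (eta / _) (T n) (v n.+1) (v n) (v N) => e t a c d e0 t1 ct a0 c0 ac.
  split; first lra.
  apply: le_trans ct; apply: (@le_trans _ _ (c * (1 - e) * (t + e))).
    by apply: ler_wpM2r => //; lra.
  (* Here [(1 - e)(t + e) = t - e(t - 1) - e^2 <= t], because [t >= 1]. *)
  rewrite -mulrA; apply: ler_wpM2l => //; nra.
have Ty : T n @[n --> \oo] --> +oo.
  have /cvgryPge Sy : S n @[n --> \oo] --> +oo.
    apply: nondecreasing_dvgn_lt; last exact: dvg_harmonic.
    by apply: nondecreasing_series => n _ _; rewrite invr_ge0.
  apply/cvgryPge => A; apply: filterS (Sy ((A - 1) / eta + S N)) => n h.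
  have : (A - 1) / eta * eta = A - 1 by rewrite divfK // gt_eqF.
  by rewrite /T; move: h; move: ((A - 1) / eta) (S n) (S N) => x y z h; nra.
have nearN : \forall n \near \oo, (N <= n)%N by exact: nbhs_infty_ge.
have TV : (T n)^-1 @[n --> \oo] --> 0.
  apply/gtr0_cvgV0 => //; apply: filterS nearN => n /Tbound[h _]; lra.
apply: (@squeeze_cvgr _ _ _ _ (fun=> 0) (fun n => v N * (T n)^-1)); last 2 first.
- exact: cvg_cst.
- by rewrite -[X in _ --> X](mulr0 (v N)); apply: cvgMr.
apply: filterS nearN => n /Tbound[h1 h2]; rewrite v0 /=.
by rewrite ler_pdivlMr //; lra.
Qed.

(** * Complex moduli, position of the roots, and decay of the ratios *)

Section Complex.
Variable R : realType.
Local Notation normc := (@ComplexField.Normc.normc R).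

Lemma normcE_Re_Im (z : R[i]) : normc z = Num.sqrt (complex.Re z ^+ 2 + complex.Im z ^+ 2).
Proof. by case: z. Qed.

Lemma normc_real (x : R) : normc x%:C = `|x|.
Proof. by rewrite normcE_Re_Im /= expr0n addr0 sqrtr_sqr. Qed.

Lemma normc_ge0 z : 0 <= normc z.
Proof. by rewrite normcE_Re_Im sqrtr_ge0. Qed.

Lemma normr_Re_le_normc z : `|complex.Re z| <= normc z.
Proof. by rewrite normcE_Re_Im -sqrtr_sqr ler_wsqrtr // lerDl sqr_ge0. Qed.

Lemma normc_prod (n : nat) (f : 'I_n -> R[i]) : normc (\prod_i f i) = \prod_i normc (f i).
Proof.
by apply: (big_morph normc); [exact: ComplexField.Normc.normcM|exact: ComplexField.Normc.normc1].
Qed.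

Lemma Re_natD (z : R[i]) n : complex.Re (z + n%:R) = complex.Re z + n%:R.
Proof. by rewrite -(rmorph_nat (real_complex R)); case: z. Qed.

Lemma Im_natD (z : R[i]) n : complex.Im (z + n%:R) = complex.Im z.
Proof. by rewrite -(rmorph_nat (real_complex R)); case: z => x y /=; rewrite addr0. Qed.

Lemma rising_real (x : R) n : rising x%:C n = (rising x n)%:C.
Proof.
by rewrite /rising rmorph_prod; apply: eq_bigr => i _; rewrite rmorphD rmorph_nat.
Qed.

Lemma addr1_real (x : R) : 1 + x%:C = (1 + x)%:C.
Proof. by rewrite rmorphD rmorph1. Qed.

Lemma rising_gt0 (x : R) n : 0 < x -> 0 < rising x n.
Proof. by move=> x0; apply: prodr_gt0 => i _; rewrite ltr_wpDr. Qed.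

(* |l + i| >= Re l + i, so a root with Re l >= 1 + k would make every factor
   as large as for l = 1 + k; the factor i = 0 then forces equality. *)
Lemma Re_root_lt (b : nat) (k : R) (l : R[i]) : (0 < b)%N -> -1 < k ->
  rising l b = rising (1 + k%:C) b -> l != 1 + k%:C -> complex.Re l < 1 + k.
Proof.
case: b => // b _ k1; rewrite !risingSl => e ne; rewrite ltNge; apply/negP => kl.
have {}e : normc l * normc (rising (l + 1) b) = (1 + k) * rising (1 + k + 1) b.
  rewrite -ComplexField.Normc.normcM e -risingSl addr1_real rising_real normc_real risingSl.
  by rewrite ger0_norm // mulr_ge0 ?ltW ?rising_gt0 //; lra.
have r0 : 0 < rising (1 + k + 1) b by apply: rising_gt0; lra.
have rl : rising (1 + k + 1) b <= normc (rising (l + 1) b).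
  rewrite /rising normc_prod; apply: ler_prod => i _; apply/andP; split.
    by rewrite addr_ge0 //; lra.
  apply: le_trans (normr_Re_le_normc _); apply: le_trans (ler_norm _).
  by rewrite Re_natD (Re_natD l 1); move: kl; rewrite (_ : 1%:R = 1) //; lra.
have nl : normc l <= 1 + k.
  rewrite -(ler_pM2r r0) -e; apply: ler_wpM2l => //; exact: normc_ge0.
have : normc l ^+ 2 <= (1 + k) ^+ 2 by rewrite ler_sqr ?nnegrE ?normc_ge0 //; lra.
rewrite normcE_Re_Im sqr_sqrtr ?addr_ge0 ?sqr_ge0 //.
case: l kl ne {e rl nl} => x y /= kl ne h.
have kx : (1 + k) ^+ 2 <= x ^+ 2 by rewrite ler_sqr ?nnegrE //; lra.
have y2 : 0 <= y ^+ 2 by exact: sqr_ge0.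
have y0 : y = 0 by apply/eqP; rewrite -sqrf_eq0; apply/eqP; lra.
have xk : x = 1 + k.
  apply/eqP; rewrite eq_le kl andbT -ler_sqr ?nnegrE; lra.
by move: ne; rewrite y0 xk addr1_real eqxx.
Qed.

Lemma normc_rising_ratio_cvg0 (k : R) (l : R[i]) : -1 < k -> complex.Re l < 1 + k ->
  normc (rising l n / rising (1 + k%:C) n) @[n --> \oo] --> 0.
Proof.
move=> k1 lk; set x := complex.Re l in lk *; set y := complex.Im l.
(* Half of the gap between [Re l] and [1 + k]; the other half absorbs the imaginary part. *)
pose d := (1 + k - x) / 2; have d0 : 0 < d by rewrite /d; lra.
(* Chosen so that [1 + k + n <= c (n + 1)], turning [d / (1 + k + n)] into a multiple of
   [1 / (n + 1)]. *)
pose c := 2 + `|k|; have c0 : 0 < c by rewrite /c; have := normr_ge0 k; lra.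
(* From [N] on, [y^2 <= 2 d (n + x)], so [(x + n)^2 + y^2 <= (x + n + d)^2]. *)
pose N := Num.bound (y ^+ 2 / (2 * d) + `|x|).
apply: (@harmonic_contraction_cvg0 _ _ (d / c) N).
- exact: divr_gt0.
- by move=> n; exact: normc_ge0.
move=> n Nn; have kn0 : 0 < 1 + k + n%:R by rewrite ltr_wpDr //; lra.
rewrite !risingS invfM mulrACA ComplexField.Normc.normcM.
apply: ler_wpM2l; first exact: normc_ge0.
rewrite ComplexField.Normc.normcM ComplexField.Normc.normcV.
rewrite addr1_real -[in X in _ / X](rmorph_nat (real_complex R)) -rmorphD normc_real gtr0_norm //.
rewrite ler_pdivrMr //.
have Nn' : y ^+ 2 / (2 * d) + `|x| < n%:R.
  by apply: lt_le_trans (unstable.ltr_bound _) _; rewrite ler_nat.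
have nx : 0 <= n%:R + x.
  have : 0 <= y ^+ 2 / (2 * d) by rewrite divr_ge0 ?sqr_ge0 //; lra.
  have := ler_norm (- x); rewrite normrN; lra.
have yb : y ^+ 2 <= 2 * d * (n%:R + x).
  rewrite mulrC -ler_pdivrMr; last by lra.
  have := ler_norm (- x); rewrite normrN; lra.
have : normc (l + n%:R) <= 1 + k - d + n%:R.
  have e : 1 + k - d = x + d by rewrite /d; field.
  rewrite normcE_Re_Im Re_natD Im_natD -/x -/y e.
  rewrite -[leRHS]ger0_norm; last by lra.
  rewrite -sqrtr_sqr ler_wsqrtr //; nra.
move=> /le_trans; apply.
have : d / c / n.+1%:R * (1 + k + n%:R) <= d.
  rewrite (_ : _ * _ = d * ((1 + k + n%:R) / (c * n.+1%:R))); last first.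
    by field; rewrite (gt_eqF c0) nat1r pnatr_eq0.
  rewrite ler_piMr ?(ltW d0) // ler_pdivrMr ?mulr_gt0 // mul1r.
  rewrite -natr1 /c; have := ler_norm k; have : 0 <= n%:R :> R by [].
  have := normr_ge0 k; nra.
by move: (d / c / _) => z; nra.
Qed.

End Complex.
(** * Exact law and limit *)

Section Law.
Variables (R : realType) (M : model R) (b : nat) (lam : 'I_b -> R[i]).
Hypotheses (hM : model_ok M) (b0 : (0 < b)%N) (lam_inj : injective lam).
Local Notation k := (kappa M).
Hypothesis lamE : forall j, rising (lam j) b = rising (1 + k%:C) b.

Lemma nk_neq0 n : n.+1%:R + k != 0.
Proof. by rewrite gt_eqF // nk_gt0. Qed.

Lemma nkC_neq0 n : n.+1%:R + k%:C != 0.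
Proof. by rewrite -(rmorph_nat (real_complex R)) -rmorphD fmorph_eq0 nk_neq0. Qed.

(** Both sides start from the indicator of [m = 1] and obey the same recursion, whose left factor
    [n + 1 + kappa] can be cancelled. *)
Lemma probK_label_law n m : (0 < m <= b)%N ->
  (probK M b n.+1 m)%:C = label_law k%:C lam n m.
Proof.
elim: n m => [|n IH] m mb.
  by rewrite probK_one label_law0 ?rmorph_nat //; exact: nkC_neq0.
apply: (mulfI (nkC_neq0 n)).
rewrite -[n.+1%:R in LHS](rmorph_nat (real_complex R)) -rmorphD -rmorphM.
case: m mb => [|[|m]] // mb.
  rewrite label_law1 //; last exact: nkC_neq0.
  by rewrite -!IH ?b0 ?leqnn // probK_rec1 // !(rmorphD, rmorphM, rmorph_nat).
rewrite label_lawS //; last exact: nkC_neq0.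
rewrite -!IH ?(ltnW mb) // probK_recS //.
by rewrite rmorphD !rmorphM rmorphB rmorphD !rmorph_nat.
Qed.

Lemma label_lawE n m : (0 < m <= b)%N -> label_law k%:C lam n m =
  \sum_(j < b)
    (binomF (lam j + n.+1%:R - 2) n * binomF (lam j + b%:R - 1) (b - m)
       * binomF ((m%:R - 1 + k)%:C) m.-1)
    / (binomF ((n.+1%:R - 1 + k)%:C) n * ('C(b, m.-1))%:R
       * (b - m + 1)%:R * binomF ((b%:R + k)%:C) b * Hdiff (lam j - 1) b).
Proof.
move=> mb; apply: eq_bigr => j _.
rewrite -(law_coef_binomF nkC_neq0 (lam j) mb).
rewrite (_ : (m%:R - 1 + k)%:C = m%:R - 1 + k%:C); last first.
  by rewrite rmorphD rmorphB rmorph1 rmorph_nat.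
rewrite (_ : (b%:R + k)%:C = b%:R + k%:C); last by rewrite rmorphD rmorph_nat.
rewrite (_ : (n.+1%:R - 1 + k)%:C = 1 + k%:C + n%:R - 1); last first.
  by rewrite rmorphD rmorphB rmorph1 rmorph_nat -natr1; ring.
rewrite (_ : lam j + n.+1%:R - 2 = lam j + n%:R - 1); last by rewrite -natr1; ring.
rewrite !(binomF_rising _ n).
have fn : n`!%:R != 0 :> R[i] by rewrite pnatr_eq0 -lt0n fact_gt0.
rewrite -(mulrA (_ / n`!%:R)) -!(mulrA (rising (1 + k%:C) n / _)).
move: (_ * binomF _ m.-1) (_ * Hdiff _ _) => p q.
rewrite !invfM invrK.
move: (rising (lam j) n) (rising _ n)^-1 q^-1 => r s q'.
rewrite (_ : r / n`!%:R * p * _ = (n`!%:R / n`!%:R) * (p * q' * (r * s))) ; last by ring.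
by rewrite divff // mul1r.
Qed.

Lemma law_coef_real (x : R) m : law_coef k%:C b x%:C m = (law_coef k b x m)%:C.
Proof.
have hE : hsum b x%:C = (hsum b x)%:C.
  rewrite /hsum rmorph_sum; apply: eq_bigr => i _.
  by rewrite fmorphV rmorphD rmorph_nat.
by rewrite /law_coef hE addr1_real -(rmorph_nat (real_complex R) m) -rmorphD !rising_real
  -!rmorphM -fmorphV -rmorphM.
Qed.

Lemma probK_cvg m : (forall j : 'I_b, j = 0%N :> nat -> lam j = 1 + k%:C) ->
  (0 < m <= b)%N -> probK M b n m @[n --> \oo] --> law_coef k b (1 + k) m.
Proof.
move=> lam0 mb; rewrite -cvg_shiftS.
pose j0 := Ordinal b0; have l0 : lam j0 = 1 + k%:C by exact: lam0.
pose ratio j n := rising (lam j) n / rising (1 + k%:C) n.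
have -> : [sequence probK M b n.+1 m]_n =
    (fun n => \sum_j complex.Re (law_coef k%:C b (lam j) m * ratio j n)).
  apply/funext => n /=.
  (* A probability is the real part of its complex embedding, which brings the limit back to real
     sequences. *)
  rewrite -[LHS]/(complex.Re (probK M b n.+1 m)%:C) probK_label_law //.
  exact: raddf_sum.
have -> : law_coef k b (1 + k) m = \sum_j (if j == j0 then law_coef k b (1 + k) m else 0).
  by rewrite -big_mkcond big_pred1_eq.
apply: cvg_big => [|j _]; first exact: add_continuous.
case: eqP => [->|/eqP jj].
  (* For the root [1 + kappa] the ratio is identically 1, so its term is the limit. *)
  apply: cvg_near_cst; apply: nearW => n.
  rewrite /ratio l0 divff ?mulr1; first by rewrite addr1_real law_coef_real.
  by apply: rising1k_neq0; exact: nkC_neq0.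
have k1 := kappa_gtN1 hM.
have lk : complex.Re (lam j) < 1 + k.
  apply: (Re_root_lt b0 k1 (lamE j)).
  by rewrite -l0; apply: contra jj => /eqP/lam_inj ->.
have h := normc_rising_ratio_cvg0 k1 lk.
apply/norm_cvg0P.
apply: (@squeeze_cvgr _ _ _ _ (fun=> 0)
  (fun n => ComplexField.Normc.normc (law_coef k%:C b (lam j) m)
            * ComplexField.Normc.normc (ratio j n))).
- by apply: nearW => n; rewrite normr_ge0 -ComplexField.Normc.normcM normr_Re_le_normc.
- exact: cvg_cst.
- by rewrite -[X in _ --> X](mulr0 (ComplexField.Normc.normc (law_coef k%:C b (lam j) m))); apply: cvgMr.
Qed.
End Law.

Theorem mainTheorem4 (R : realType) (M : model R) (b : nat)
  (lam : 'I_b -> R[i]) :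
  model_ok M -> (1 <= b)%N ->
  injective lam ->
  (forall j, \prod_(k < b) (lam j + k%:R)
             = \prod_(k < b) ((kappa M)%:C + k.+1%:R)) ->
  (forall j : 'I_b, j = 0%N :> nat -> lam j = 1 + (kappa M)%:C) ->
  (forall n m : nat, (1 <= n)%N -> (1 <= m <= b)%N ->
     (probK M b n m)%:C =
     \sum_(j < b)
       (binomF (lam j + n%:R - 2) n.-1 * binomF (lam j + b%:R - 1) (b - m)
          * binomF ((m%:R - 1 + kappa M)%:C) m.-1)
       / (binomF ((n%:R - 1 + kappa M)%:C) n.-1 * ('C(b, m.-1))%:R
          * (b - m + 1)%:R * binomF ((b%:R + kappa M)%:C) b
          * Hdiff (lam j - 1) b))
  /\
  (forall m : nat, (1 <= m <= b)%N ->
     (fun n => probK M b n m) @ \oo -->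
       (binomF (b%:R + kappa M) (b - m) * binomF (m%:R - 1 + kappa M) m.-1
       / (('C(b, m.-1))%:R * (b - m + 1)%:R * binomF (b%:R + kappa M) b
          * Hdiff (kappa M) b) : R)).
Proof.
move=> hM b0 lam_inj lamP lam0.
have lamE j : rising (lam j) b = rising (1 + (kappa M)%:C) b.
  rewrite /rising lamP; apply: eq_bigr => i _.
  by rewrite -nat1r; ring.
split=> [[//|n] m _ mb|m mb].
  by rewrite (probK_label_law hM b0 lam_inj lamE) // label_lawE.
have := probK_cvg hM b0 lam_inj lamE lam0 mb.
(* The limit is the dominant coefficient, rewritten over the reals by the same binomial identity at
   [x = 1 + kappa]. *)
rewrite -(law_coef_binomF (nk_neq0 hM)) //.
have -> : 1 + kappa M + b%:R - 1 = b%:R + kappa M by ring.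
by have -> : 1 + kappa M - 1 = kappa M by ring.
Qed.
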